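(* Let $\mathcal{T}=(V,E)$ be a countably infinite rooted and leafless directed tree, $\boldsymbol{\beta}=\{\beta_v\}_{v\in V}\subseteq(0,\infty)$ and $\boldsymbol{\lambda}=\{\lambda_v\}_{v\in V^\circ}\subseteq(0,\infty)$. Let the weighted shift $S_{\boldsymbol{\lambda}}$ on $\mathcal{T}_{\boldsymbol{\beta}}$ be bounded on $\ell^2(\boldsymbol{\beta})$, i.e. $S_{\boldsymbol{\lambda}}\in\mathbf{B}(\ell^2(\boldsymbol{\beta}))$. Then for every $\hat\varphi\in\mathcal{M}(\mathcal{T}_{\boldsymbol{\beta}},\boldsymbol{\lambda})$ and every $w\in\mathbb{C}$ with $|w|<r(S_{\boldsymbol{\lambda}})$ the series $\sum_{n\in\mathbb{N}_0}\hat\varphi(n)\,w^n$ is absolutely convergent.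
   Context: $\mathbb{N}_0=\{0,1,2,\dots\}$; $r(A)$ denotes the spectral radius of a bounded operator $A$. A rooted directed tree $\mathcal{T}=(V,E)$ is a connected directed graph without circuits having a unique vertex $\mathrm{root}$ without a parent and such that every $v\in V^\circ:=V\setminus\{\mathrm{root}\}$ has a unique parent $\mathrm{par}(v)$, i.e. a unique $u$ with $(u,v)\in E$. $\mathrm{par}^k$ is the $k$-fold composition of $\mathrm{par}$ ($\mathrm{par}^0$ the identity); $\mathrm{Chi}(u)=\{v\in V:(u,v)\in E\}$; leafless means every vertex has at least one child; $|v|$ is the unique $k\in\mathbb{N}_0$ with $\mathrm{par}^k(v)=\mathrm{root}$. For $v$ a descendant of $u$, i.e. $\mathrm{par}^n(v)=u$ for some $n\in\mathbb{N}_0$, put $\lambda_{u|v}=\prod_{j=0}^{n-1}\lambda_{\mathrm{par}^j(v)}$ (equal to $1$ if $u=v$). $\ell^2(\boldsymbol{\beta})$ is the Hilbert space of all $f:V\to\mathbb{C}$ with $\|f\|_{\boldsymbol\beta}^2=\sum_{v\in V}|f(v)|^2\beta_v<\infty$, with $\langle f,g\rangle_{\boldsymbol\beta}=\sum_{v\in V} f(v)\overline{g(v)}\beta_v$. $\mathcal{T}_{\boldsymbol\beta}$ denotes the pair $(\mathcal{T},\boldsymbol\beta)$. The weighted shift $S_{\boldsymbol{\lambda}}$ on $\mathcal{T}_{\boldsymbol\beta}$ is given by $(S_{\boldsymbol\lambda}f)(v)=\lambda_v f(\mathrm{par}(v))$ for $v\in V^\circ$, $(S_{\boldsymbol\lambda}f)(\mathrm{root})=0$,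 on the domain of all $f\in\ell^2(\boldsymbol\beta)$ for which the resulting function lies in $\ell^2(\boldsymbol\beta)$. For $\hat\varphi:\mathbb{N}_0\to\mathbb{C}$ let $(\Gamma_{\hat\varphi}f)(v)=\sum_{k=0}^{|v|}\lambda_{\mathrm{par}^k(v)|v}\,\hat\varphi(k)\,f(\mathrm{par}^k(v))$ for $f\in\mathbb{C}^V$, $v\in V$. The multiplication operator $M_{\hat\varphi}$ in $\ell^2(\boldsymbol\beta)$ has domain $\{f\in\ell^2(\boldsymbol\beta):\Gamma_{\hat\varphi}f\in\ell^2(\boldsymbol\beta)\}$ and acts by $M_{\hat\varphi}f=\Gamma_{\hat\varphi}f$. $\mathcal{M}(\mathcal{T}_{\boldsymbol\beta},\boldsymbol\lambda)$ is the set of all $\hat\varphi:\mathbb{N}_0\to\mathbb{C}$ for which the domain of $M_{\hat\varphi}$ is all of $\ell^2(\boldsymbol\beta)$ (then $M_{\hat\varphi}$ is bounded). *)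

(* Defs.v *)
From mathcomp Require Import all_boot all_order all_algebra.
From mathcomp Require Export complex.
From mathcomp Require Import all_classical all_reals all_analysis.

Set Implicit Arguments.
Unset Strict Implicit.
Unset Printing Implicit Defensive.
Import Order.TTheory GRing.Theory Num.Theory.
Import numFieldNormedType.Exports.
Local Open Scope classical_set_scope.
Local Open Scope ring_scope.
Local Open Scope complex_scope.

(* C is rendered as R[i] for an arbitrary R : realType.  This is the R-valued
   modulus; the norm `|z| of R[i] takes its values in R[i]. *)
Notation cmod := ComplexField.Normc.normc.

Section Trees.
Variables (V : choiceType) (E : rel V).

(* [ucycle E s] means that the vertices of s are pairwise distinct and form a
   closed directed path, so the second field also excludes loops. *)
Record rooted_directed_tree (root : V) : Prop := RootedDirectedTree {
  tree_connected : forall u v, exists p,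
    path (fun x y => E x y || E y x) u p /\ last u p = v ;
  tree_no_circuit : forall s, ucycle E s -> s = [::] ;
  tree_root : forall v, (forall u, ~~ E u v) <-> v = root ;
  tree_unique_parent : forall v, v <> root -> exists! u, E u v }.

Definition leafless := forall u, exists v, E u v.

(* The root, having no parent, is mapped to itself. *)
Definition par (v : V) : V := xget v [set u | E u v].

(* The n with par^n(v) = u, for v a descendant of u, and 0 otherwise.  Because
   [par] fixes the root, minimality is needed to single out n when u is the
   root, where the iterates after the first hit are not genuine ancestors. *)
Definition gen_diff (u v : V) : nat :=
  xget 0%N [set n | iter n par v = u /\
                    forall m, (m < n)%N -> iter m par v <> u].

Definition depth (root v : V) : nat := gen_diff root v.

Definition path_weight (R : realType) (lambda : V -> R) (u v : V) : R :=
  \prod_(j < gen_diff u v) lambda (iter j par v).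

End Trees.

Section Operators.
Variables (R : realType) (V : choiceType) (beta : V -> R).
Implicit Types f g : V -> R[i].

Definition l2_sqnorm f : \bar R :=
  (\esum_(v in [set: V]) (cmod (f v) ^+ 2 * beta v)%:E)%E.

Definition l2 : set (V -> R[i]) := [set f | (l2_sqnorm f < +oo)%E].

Definition l2_norm f : R := Num.sqrt (fine (l2_sqnorm f)).

(* A possibly not everywhere defined operator: only the values of [op_fun] on
   [op_dom] are meaningful. *)
Record operator := Operator {
  op_dom : set (V -> R[i]) ;
  op_fun :> (V -> R[i]) -> (V -> R[i]) }.

(* Membership in B(l^2(beta)). *)
Record bounded_operator (A : operator) : Prop := BoundedOperator {
  bounded_operator_dom : op_dom A = l2 ;
  bounded_operator_stable : forall f, l2 f -> l2 (A f) ;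
  bounded_operator_linear : forall (a : R[i]) f g, l2 f -> l2 g ->
    A (fun v => a * f v + g v) = (fun v => a * A f v + A g v) ;
  bounded_operator_bounded : exists M : R, forall f, l2 f ->
    l2_norm (A f) <= M * l2_norm f }.

(* z lies in the spectrum when A - z I has no inverse in B(l^2(beta)). *)
Definition spectrum (A : operator) : set R[i] :=
  [set z | ~ exists B : operator, bounded_operator B /\
     forall f, l2 f ->
       B (fun v => A f v - z * f v) = f /\
       (fun v => A (B f) v - z * B f v) = f].

Definition spectral_radius (A : operator) : R :=
  sup [set cmod z | z in spectrum A].

End Operators.

Section Shifts.
Variables (R : realType) (V : choiceType) (E : rel V) (root : V).
Variables (beta lambda : V -> R).

(* lambda is a family indexed by the vertices other than the root: its value at
   the root is never used. *)
Definition shift_fun (f : V -> R[i]) (v : V) : R[i] :=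
  if v == root then 0 else (lambda v)%:C * f (par E v).

Definition weighted_shift : operator R V :=
  Operator [set f | l2 beta f /\ l2 beta (shift_fun f)] shift_fun.

Definition Gamma (phi : nat -> R[i]) (f : V -> R[i]) (v : V) : R[i] :=
  \sum_(k < (depth E root v).+1)
     (path_weight E lambda (iter k (par E) v) v)%:C * phi k *
     f (iter k (par E) v).

Definition mult_operator (phi : nat -> R[i]) : operator R V :=
  Operator [set f | l2 beta f /\ l2 beta (Gamma phi f)] (Gamma phi).

Definition multipliers : set (nat -> R[i]) :=
  [set phi | op_dom (mult_operator phi) = l2 beta].

End Shifts.

(* Main.v *)
(* A multiplier phi gives an everywhere defined operator [Gamma phi] on l^2, and
   a gliding hump bounds it uniformly on normalised vertex indicators: each hump
   is placed outside the finite ancestor-closed set on which the previous ones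
   act, so it does not disturb their images there.  As the supports of the
   S^k e_u are pairwise disjoint in k for fixed u and in u for fixed k, this
   yields |phi(k)| ||S^k|| <= K.  Finally |z|^k <= ||S^k|| for z in the spectrum: S - z
   always has the pointwise inverse given by the formal Neumann series, and
   ||S^k|| < |z|^k makes it bounded.  Only finite sums over ancestor-closed sets
   are estimated, so that every quantity absorbed is finite.  Hence
   |phi(k)| |z|^k is bounded for some |z| > |w|, and the series is dominated by a
   geometric one. *)
Require Import Defs.
From mathcomp Require Import all_boot all_order all_algebra.
From mathcomp Require Import all_classical all_reals all_analysis.
From mathcomp Require Import lra ring zify.
Import Order.TTheory GRing.Theory Num.Theory.
Import numFieldNormedType.Exports.
Local Open Scope classical_set_scope.
Local Open Scope ring_scope.
Local Open Scope complex_scope.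

(** * Square sums over finite vertex sets and the norm of $\ell^2(\beta)$ *)

Section SquareSums.
Context {R : realType} {V : choiceType} (beta : V -> R).
Hypothesis beta_gt0 : forall v, 0 < beta v.
Implicit Types (f g : V -> R[i]) (s t : seq V).

Definition sqsum s f : R := \sum_(v <- s) cmod (f v) ^+ 2 * beta v.

Lemma cmod_ge0 (x : R[i]) : 0 <= cmod x.
Proof. by case: x => a b; apply: sqrtr_ge0. Qed.

Lemma cmod_gt0 (x : R[i]) : x != 0 -> 0 < cmod x.
Proof.
move=> x0; rewrite lt0r cmod_ge0 andbT.
by apply: contra x0 => /eqP/ComplexField.Normc.eq0_normc ->.
Qed.

Lemma cmodX (x : R[i]) n : cmod (x ^+ n) = cmod x ^+ n.
Proof.
elim: n => [|n IH]; first by rewrite !expr0 ComplexField.Normc.normc1.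
by rewrite !exprS ComplexField.Normc.normcM IH.
Qed.

Lemma sqterm_ge0 f v : 0 <= cmod (f v) ^+ 2 * beta v.
Proof. by rewrite mulr_ge0 ?sqr_ge0 // ltW. Qed.

Lemma sqsum_ge0 s f : 0 <= sqsum s f.
Proof. by apply: sumr_ge0 => v _; exact: sqterm_ge0. Qed.

Lemma sqsum_le_l2 s f : uniq s -> ((sqsum s f)%:E <= l2_sqnorm beta f)%E.
Proof.
move=> us; apply: esum_ge; exists [set` s]; first by split=> //; apply: finite_seq.
by rewrite -fsbig_seq // sumEFin.
Qed.

Lemma l2_sqnorm_le f (C : R) :
  (forall s, uniq s -> sqsum s f <= C) -> (l2_sqnorm beta f <= C%:E)%E.
Proof.
move=> fC; apply: ge_ereal_sup => _ [A [finA _] <-].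
by rewrite fsbig_finite //= sumEFin lee_fin fC // fset_uniq.
Qed.

Lemma l2_sqnorm_ge0 f : (0 <= l2_sqnorm beta f)%E.
Proof. by apply: esum_ge0 => v _; rewrite lee_fin sqterm_ge0. Qed.

Lemma l2_sqnorm_fin f : l2 beta f -> l2_sqnorm beta f = (fine (l2_sqnorm beta f))%:E.
Proof. by move=> lf; rewrite fineK // ge0_fin_numE // l2_sqnorm_ge0. Qed.

Lemma l2_sqsum_le f s : l2 beta f -> uniq s -> sqsum s f <= l2_norm beta f ^+ 2.
Proof.
move=> lf us; rewrite sqr_sqrtr ?fine_ge0 ?l2_sqnorm_ge0 //.
by rewrite -lee_fin -l2_sqnorm_fin // sqsum_le_l2.
Qed.

Lemma sqsum_le_l2_mem f (C : R) : (forall s, uniq s -> sqsum s f <= C) -> l2 beta f.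
Proof. by move=> /l2_sqnorm_le fC; apply: le_lt_trans fC (ltry _). Qed.

Lemma l2_norm_le f (C : R) :
  (forall s, uniq s -> sqsum s f <= C) -> l2_norm beta f ^+ 2 <= C.
Proof.
move=> fC; rewrite sqr_sqrtr ?fine_ge0 ?l2_sqnorm_ge0 //.
by rewrite -lee_fin -l2_sqnorm_fin ?l2_sqnorm_le //; apply: sqsum_le_l2_mem fC.
Qed.

Lemma l2_norm_ge0 f : 0 <= l2_norm beta f.
Proof. exact: sqrtr_ge0. Qed.

Lemma sqsum_sub s t f : uniq s -> {subset s <= t} -> sqsum s f <= sqsum t f.
Proof.
move=> us st; rewrite /sqsum; elim: s us t st => [|a s IH] /= us t st.
  by rewrite big_nil sqsum_ge0.
have /andP[a_s us'] := us.
have at_ : a \in t by apply: st; rewrite mem_head.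
rewrite big_cons (perm_big _ (perm_to_rem at_)) big_cons lerD2l IH // => x xs.
have xt : x \in t by apply: st; rewrite inE xs orbT.
move: xt; rewrite (perm_mem (perm_to_rem at_)) inE => /orP[/eqP xa|//].
by rewrite -xa xs in a_s.
Qed.

Lemma sqsum_eq s f g : {in s, f =1 g} -> sqsum s f = sqsum s g.
Proof. by move=> fg; apply: eq_big_seq => v /fg ->. Qed.

Lemma sqsumZ s (a : R[i]) f :
  sqsum s (fun v => a * f v) = cmod a ^+ 2 * sqsum s f.
Proof.
rewrite /sqsum mulr_sumr; apply: eq_bigr => v _.
by rewrite ComplexField.Normc.normcM exprMn mulrA.
Qed.

(** The defect dominates a multiple of the square $(a-eb)^2$, where $a,b$ are the two moduli. A
    small [e] keeps the factor of the second term near 1, as the later absorption argument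
    requires. *)
Lemma cmodD_sqr_le (e : R) (x y : R[i]) : 0 < e ->
  cmod (x + y) ^+ 2 <= (1 + e^-1) * cmod x ^+ 2 + (1 + e) * cmod y ^+ 2.
Proof.
move=> e0; set a := cmod x; set b := cmod y.
have /le_trans -> // : cmod (x + y) ^+ 2 <= (a + b) ^+ 2.
  by rewrite ler_sqr ?nnegrE ?addr_ge0 ?cmod_ge0 // le_normcD.
rewrite -subr_ge0.
have -> : (1 + e^-1) * a ^+ 2 + (1 + e) * b ^+ 2 - (a + b) ^+ 2
          = e^-1 * (a - e * b) ^+ 2 by field; rewrite gt_eqF.
by rewrite mulr_ge0 ?sqr_ge0 // invr_ge0 ltW.
Qed.

Lemma sqsumD_le (e : R) s f g : 0 < e ->
  sqsum s (fun v => f v + g v) <=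
  (1 + e^-1) * sqsum s f + (1 + e) * sqsum s g.
Proof.
move=> e0; rewrite /sqsum !mulr_sumr -big_split; apply: ler_sum => v _ /=.
by rewrite [leRHS](_ : _ = ((1 + e^-1) * cmod (f v) ^+ 2 + (1 + e) * cmod (g v) ^+ 2)
  * beta v); [rewrite ler_pM2r // cmodD_sqr_le | ring].
Qed.

Definition indic_vertex (u v : V) : R[i] := if v == u then 1 else 0.

Lemma sqsumD_indic s f u (c : R[i]) : uniq s -> f u = 0 ->
  sqsum s (fun v => f v + c * indic_vertex u v)
  = sqsum s f + (if u \in s then cmod c ^+ 2 * beta u else 0).
Proof.
move=> us fu0.
have -> : (if u \in s then cmod c ^+ 2 * beta u else 0)
    = \sum_(v <- s | v == u) cmod c ^+ 2 * beta u.
  rewrite -big_filter; case: ifPn => [uins|uNs].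
    by rewrite filter_pred1_uniq // big_seq1.
  by rewrite big_filter big1_seq // => v /andP[/eqP->]; rewrite (negPf uNs).
rewrite [X in _ + X]big_mkcond -big_split; apply: eq_bigr => v _ /=.
rewrite /indic_vertex; case: eqVneq => [->|_]; last by rewrite mulr0 !addr0.
by rewrite fu0 mulr1 add0r ComplexField.Normc.normc0 expr0n mul0r add0r.
Qed.

Lemma sqsum0 s : sqsum s (fun=> 0) = 0.
Proof.
by rewrite /sqsum big1 // => v _; rewrite ComplexField.Normc.normc0 expr0n mul0r.
Qed.

Lemma sqsum_indic_le s u : uniq s -> sqsum s (indic_vertex u) <= beta u.
Proof.
move=> us; have := sqsumD_indic s (fun=> 0) u 1 us erefl.
under sqsum_eq => v _ do rewrite add0r mul1r.
rewrite sqsum0 add0r ComplexField.Normc.normc1 expr1n mul1r => ->.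
by case: ifP => // _; apply: ltW.
Qed.

Lemma l2_indic u : l2 beta (indic_vertex u).
Proof. by apply: (@sqsum_le_l2_mem _ (beta u)) => s; apply: sqsum_indic_le. Qed.

End SquareSums.

(** * Gliding hump: a uniform bound on vertex indicators *)

Section UniformBound.
Context {R : realType} {V : choiceType} (beta : V -> R) (p : V -> V).
Hypothesis beta_gt0 : forall v, 0 < beta v.
Implicit Types (f g : V -> R[i]) (s t : seq V).

(** With [p] the parent map these are the ancestor-closed sets, on which an operator that looks only
    at ancestors acts locally. *)
Definition stable_seq s := {in s, forall v, p v \in s}.

Hypothesis stable_closure : forall s,
  exists t, [/\ uniq t, stable_seq t & {subset s <= t}].

Variable G : (V -> R[i]) -> V -> R[i].
Hypothesis G_local : forall s f g,
  stable_seq s -> {in s, f =1 g} -> {in s, G f =1 G g}.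
Hypothesis G_linear : forall f g (c : R[i]),
  G (fun v => f v + c * g v) =1 (fun v => G f v + c * G g v).
Hypothesis G_l2 : forall f, l2 beta f -> l2 beta (G f).

Let ratio_le (K : R) u :=
  forall s, uniq s -> sqsum beta s (G (indic_vertex u)) <= K * beta u.

(** Finitely many vertices share a bound, so if no uniform bound exists, bad vertices occur outside
    any given finite set. *)
Let ratio_le_seq (A : seq V) : exists2 K, 0 <= K & {in A, forall u, ratio_le K u}.
Proof.
elim: A => [|a A [K K0 KA]]; first by exists 0.
set N := l2_norm beta (G (indic_vertex a)) ^+ 2 / beta a.
have N0 : 0 <= N by rewrite divr_ge0 ?sqr_ge0 // ltW.
exists (K + N) => [|u]; first exact: addr_ge0.
rewrite inE => /predU1P[->|uA] s us.
  rewrite (@le_trans _ _ (N * beta a)) //; last by rewrite ler_pM2r // lerDr.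
  by rewrite /N divfK ?gt_eqF // l2_sqsum_le //; apply/G_l2/l2_indic.
by apply: le_trans (KA u uA s us) _; rewrite ler_pM2r // lerDl.
Qed.

(** The state after [j] humps: a function and a finite set carrying it. The bound is
    $\sum_{i<j}2^{-i}$, the [i]-th hump being allotted the squared norm $2^{-i}$. *)
Let partial_hump (j : nat) (x : (V -> R[i]) * seq V) :=
  [/\ uniq x.2, stable_seq x.2, forall v, v \notin x.2 -> x.1 v = 0
    & forall s, uniq s -> sqsum beta s x.1 <= 2 - 2 * 2^-1 ^+ j].

Let hump_step (j : nat) (x y : (V -> R[i]) * seq V) :=
  [/\ partial_hump j.+1 y, {subset x.2 <= y.2}, {in x.2, y.1 =1 x.1}
    & j%:R <= sqsum beta y.2 (G y.1)].

Let hump_step_ex j x : (forall K, exists u, ~ ratio_le K u) ->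
  partial_hump j x -> exists y, hump_step j x y.
Proof.
case: x => f A unb [/= uA sA fA fle].
have lf : l2 beta f by apply: sqsum_le_l2_mem fle.
have lGf := G_l2 _ lf.
set D := l2_norm beta (G f) ^+ 2.
have D0 : 0 <= D by apply: sqr_ge0.
have [K0 K00 K0A] := ratio_le_seq A.
have h0 : (0 : R) < 2^-1 ^+ j by rewrite exprn_gt0 // invr_gt0.
(* [K0] forces the bad vertex out of [A]; the other term makes the image of its indicator, scaled to
   squared norm $2^{-j}$, still reach $2(j+D)$. *)
set K := K0 + 2 * (j%:R + D) / 2^-1 ^+ j.
have hK : 2 * (j%:R + D) / 2^-1 ^+ j <= K by rewrite lerDr.
have [u] := unb K.
move=> /existsNP[s] /not_implyP[us] /negP; rewrite -ltNge => Ks.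
have uNA : u \notin A.
  apply/negP => uinA; have := K0A u uinA s us; apply/negP; rewrite -ltNge.
  apply: le_lt_trans Ks; rewrite ler_pM2r // lerDl divr_ge0 ?(ltW h0) //.
  by rewrite mulr_ge0 // addr_ge0.
have [t [ut st At]] := stable_closure (u :: A ++ s).
have uint : u \in t by apply: At; rewrite mem_head.
have At' : {subset A <= t} by move=> v vA; apply: At; rewrite inE mem_cat vA /= orbT.
have st' : {subset s <= t} by move=> v vs; apply: At; rewrite inE mem_cat vs !orbT.
set c : R := Num.sqrt (2^-1 ^+ j / beta u).
have c0 : 0 <= c by apply: sqrtr_ge0.
have c2 : c ^+ 2 = 2^-1 ^+ j / beta u.
  by rewrite sqr_sqrtr // divr_ge0 // ltW.
have nc : cmod c%:C = c by rewrite /= expr0n addr0 sqrtr_sqr ger0_norm.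
have cb : c ^+ 2 * beta u = 2^-1 ^+ j by rewrite c2 divfK // gt_eqF.
exists ((fun v => f v + c%:C * indic_vertex u v), t); split=> /=.
- split=> //= [v vNt|s' us'].
    rewrite fA ?add0r; last by apply: contra vNt => vA; exact: At'.
    by rewrite /indic_vertex; case: eqVneq vNt => [->|_ _]; rewrite ?uint ?mulr0.
  rewrite sqsumD_indic ?fA // nc cb exprS.
  have := fle s' us'; case: ifP => _; lra.
- exact: At'.
- move=> v vA; rewrite /indic_vertex; case: eqVneq => [vu|_].
    by rewrite -vu vA in uNA.
  by rewrite mulr0 addr0.
have eqG : sqsum beta t (G (fun v => f v + c%:C * indic_vertex u v)) =
    sqsum beta t (fun v => G f v + c%:C * G (indic_vertex u) v).
  by apply: sqsum_eq => v _; rewrite G_linear.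
rewrite eqG.
(* [|b|^2 <= 2 |a|^2 + 2 |a + b|^2] with [a = G f] and [b] the image of the new hump *)
have := @sqsumD_le _ _ _ beta_gt0 1 t (fun v => - G f v)
  (fun v => G f v + c%:C * G (indic_vertex u) v) ltr01.
under sqsum_eq => v _ do rewrite addKr.
rewrite sqsumZ nc.
have -> : sqsum beta t (fun v => - G f v) = sqsum beta t (G f).
  by apply: eq_bigr => v _; rewrite normcN.
have Dt : sqsum beta t (G f) <= D by apply: l2_sqsum_le.
have st_le := @sqsum_sub _ _ _ beta_gt0 s t (G (indic_vertex u)) us st'.
rewrite invr1 => main.
have : 2 * (j%:R + D) <= c ^+ 2 * sqsum beta t (G (indic_vertex u)).
  apply: (@le_trans _ _ (c ^+ 2 * (K * beta u))); last first.
    by rewrite ler_wpM2l ?sqr_ge0 // ltW // (lt_le_trans Ks).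
  by rewrite mulrCA cb -ler_pdivrMr.
move=> big; lra.
Qed.

(** Otherwise the humps add up to some [f] in $\ell^2(\beta)$, and by locality [G f] has square sums
    at least [j] for every [j]. *)
Lemma uniform_indic_bound : exists K, forall u s, uniq s ->
  sqsum beta s (G (indic_vertex u)) <= K * beta u.
Proof.
apply: contrapT => nK.
have unb K : exists u, ~ ratio_le K u.
  by apply/existsNP => KP; apply: nK; exists K.
(* The implication makes the relation total, as choice requires; outside partial humps any value
   will do. *)
have [F FP] : {F & forall jx, partial_hump jx.1 jx.2 -> hump_step jx.1 jx.2 (F jx)}.
  apply: (@choice _ _ (fun jx y => partial_hump jx.1 jx.2 -> hump_step jx.1 jx.2 y))
    => -[j x]; have [hx|nhx] := pselect (partial_hump j x).
    by have [y yP] := hump_step_ex j x unb hx; exists y.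
  by exists x.
pose x := nat_rect (fun=> ((V -> R[i]) * seq V)%type) (fun=> 0, [::]) (fun j y => F (j, y)).
have x0 : partial_hump 0 (x 0%N).
  by split=> //= s us; rewrite sqsum0 expr0 mulr1 subrr.
have xP j : partial_hump j (x j).
  by elim: j => // j IH; have [] := FP (j, x j) IH.
have xS j : hump_step j (x j) (x j.+1) by apply: (FP (j, x j)); apply: xP.
have xmono i k : {subset (x i).2 <= (x (k + i)%N).2} /\
    {in (x i).2, (x (k + i)%N).1 =1 (x i).1}.
  elim: k => [|k [IHs IHe]]; first by split.
  have [_ ss ee _] := xS (k + i)%N.
  split=> v vi; first exact/ss/IHs.
  by rewrite addSn ee ?IHe // IHs.
(* Pointwise limit: a value is frozen once its vertex enters some [(x J).2], and stays 0 if it never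
   does. *)
have [f fP] : {f : V -> R[i] & forall v, exists J, forall j, (J <= j)%N -> f v = (x j).1 v}.
  apply: (@choice _ _ (fun v a => exists J, forall j, (J <= j)%N -> a = (x j).1 v)) => v.
  have [[J vJ]|nJ] := pselect (exists J, v \in (x J).2).
    exists ((x J).1 v), J => j Jj; rewrite -(subnK Jj).
    by rewrite (xmono J (j - J)%N).2.
  exists 0, 0%N => j _; have [_ _ -> //] := xP j.
  by apply/negP => vj; apply: nJ; exists j.
have fA j : {in (x j).2, f =1 (x j).1}.
  move=> v vj; have [J JP] := fP v; rewrite (JP (J + j)%N) ?leq_addr //.
  by rewrite (xmono j J).2.
have lf : l2 beta f.
  apply: (@sqsum_le_l2_mem _ _ _ _ 2) => s us.
  have [J JP] : exists J, {in s, f =1 (x J).1}.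
    suff [J JP] : exists J, {in s, forall v j, (J <= j)%N -> f v = (x j).1 v}.
      by exists J => v vs; apply: JP.
    elim: s {us} => [|a s [J JP]]; first by exists 0%N.
    have [J' J'P] := fP a; exists (maxn J J') => v.
    rewrite inE => /predU1P[->|vs] j; rewrite geq_max => /andP[Jj J'j].
      exact: J'P.
    exact: JP.
  rewrite (sqsum_eq _ _ _ _ JP); have [_ _ _ /(_ s us)] := xP J.
  move=> /le_trans; apply; rewrite gerBl mulr_ge0 // exprn_ge0 // invr_ge0 //.
have lGf := G_l2 _ lf.
set D := l2_norm beta (G f) ^+ 2.
(* This [j] exceeds [D], while stage [j.+1] yields a square sum of at least [j]. *)
set j := (Num.truncn D).+1.
have [[uA sA _ _] _ _ le_j] := xS j.
have : sqsum beta (x j.+1).2 (G f) <= D by apply: l2_sqsum_le.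
rewrite (sqsum_eq _ _ _ _ (G_local _ _ _ sA (fA j.+1))).
move=> /(le_trans le_j); apply/negP; rewrite -ltNge.
by rewrite truncnS_gt.
Qed.

End UniformBound.

(** * Ancestors and depth in a rooted directed tree *)

Section Tree.
Context {V : choiceType} (E : rel V) (root : V).
Hypothesis tree : rooted_directed_tree E root.
Implicit Types (u v : V).

Let p := par E.

Lemma par_edge u v : E u v -> par E v = u.
Proof.
move=> Euv; have vr : v <> root.
  by move=> /(tree_root tree)/(_ u); rewrite Euv.
have [u' [_ uniq_u']] := tree_unique_parent tree vr.
by apply: xget_unique => // y Eyv; rewrite -(uniq_u' y) // (uniq_u' u).
Qed.

Lemma par_root : par E root = root.
Proof. by apply: xgetPN => u; apply/negP; have /(tree_root tree) := erefl root. Qed.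

(** The property spreads along an undirected path from the root: a downward edge adds one step, an
    upward edge drops one, or keeps zero steps because [par] fixes the root. *)
Lemma reach_root v : exists n, iter n (par E) v = root.
Proof.
have propagate q x : (exists n, iter n p x = root) ->
    path (fun x y => E x y || E y x) x q -> exists n, iter n p (last x q) = root.
  elim: q x => //= y q IH x [n xn] /andP[/orP[Exy|Eyx]]; apply: IH.
    by exists n.+1; rewrite iterSr /p (par_edge _ _ Exy).
  case: n xn => [|n] xn.
    by exists 0%N; rewrite /= -(par_edge _ _ Eyx) (xn : x = root) par_root.
  by exists n; rewrite -xn iterSr /p (par_edge _ _ Eyx).
have [q [path_q <-]] := tree_connected tree root v.
by apply: propagate path_q; exists 0%N.
Qed.

Lemma gen_diff_eq u v n : iter n (par E) v = u ->
  (forall m, (m < n)%N -> iter m (par E) v <> u) -> gen_diff E u v = n.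
Proof.
move=> nu min_n; apply: xget_unique => // m [mu min_m].
case: (ltngtP m n) => // [/min_n|/min_m] //.
Qed.

Lemma depthP v : iter (depth E root v) (par E) v = root /\
  forall m, (m < depth E root v)%N -> iter m (par E) v <> root.
Proof.
apply: (@xgetPex _ 0%N [set n | iter n (par E) v = root /\
  forall m, (m < n)%N -> iter m (par E) v <> root]).
have ex : exists n, iter n (par E) v == root.
  by have [n /eqP] := reach_root v; exists n.
exists (ex_minn ex); case: ex_minnP => n /eqP nr min_n; split=> // m mn /eqP/min_n.
by rewrite leqNgt mn.
Qed.

Lemma depth_root : depth E root root = 0%N.
Proof. exact: gen_diff_eq. Qed.

Lemma depth_par v : v <> root -> depth E root v = (depth E root (par E v)).+1.
Proof.
move=> vr; have [dr min_d] := depthP (par E v).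
apply: gen_diff_eq => [|[|m] md]; rewrite ?iterSr //.
exact: min_d.
Qed.

(** An earlier hit of the same ancestor, followed by [depth E root v - k] further steps, would reach
    the root too early. *)
Lemma gen_diff_iter k v : (k <= depth E root v)%N ->
  gen_diff E (iter k (par E) v) v = k.
Proof.
move=> kd; have [dr min_d] := depthP v.
apply: gen_diff_eq => // m mk mkE.
apply: (min_d (m + (depth E root v - k))%N); first by lia.
by rewrite addnC iterD mkE -iterD subnK.
Qed.

Lemma stable_closure_par (s : seq V) :
  exists t, [/\ uniq t, stable_seq (par E) t & {subset s <= t}].
Proof.
pose t := flatten [seq [seq iter k p v | k <- iota 0 (depth E root v).+1] | v <- s].
exists (undup t); split=> [|u|v vs]; rewrite ?undup_uniq ?mem_undup //.
- move=> /flatten_mapP[v vs /mapP[k kd ->]]; apply/flatten_mapP; exists v => //.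
  have [kd'|kd'] := ltnP k (depth E root v).
    by apply/mapP; exists k.+1; rewrite // mem_iota.
  apply/mapP; exists k => //; rewrite -iterS.
  have -> : k = depth E root v by move: kd; rewrite mem_iota; lia.
  by rewrite iterS /p (depthP v).1 par_root.
by apply/flatten_mapP; exists v => //; apply/mapP; exists 0%N.
Qed.

Lemma iter_stable (s : seq V) k v : stable_seq (par E) s -> v \in s ->
  iter k (par E) v \in s.
Proof. by move=> sts vs; elim: k => //= k; apply: sts. Qed.

(** * The shift, its powers and formal power series in it *)

Section Shift.
Context {R : realType} (lambda : V -> R).
Local Notation S := (shift_fun E root lambda).
Local Notation Gam := (Gamma E root lambda).
Implicit Types (f g : V -> R[i]).

Lemma iter_shift_fun k f v : iter k S f v =
  if (k <= depth E root v)%N then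
    (path_weight E lambda (iter k (par E) v) v)%:C * f (iter k (par E) v)
  else 0.
Proof.
(* The raw product suits the induction; [gen_diff_iter] identifies it with [path_weight] only for
   [k] up to the depth. *)
have -> : iter k S f v =
  if (k <= depth E root v)%N then
    (\prod_(j < k) lambda (iter j (par E) v))%:C * f (iter k (par E) v)
  else 0.
  elim: k v => [|k IH] v; first by rewrite big_ord0 mul1r.
  rewrite iterS /shift_fun -/S; case: eqVneq => [->|/eqP vr].
    by rewrite depth_root.
  rewrite IH (depth_par v vr) ltnS; case: ifP => _; last by rewrite mulr0.
  rewrite -iterSr big_ord_recl mulrA -rmorphM; congr (_%:C * _).
  by congr (_ * _); apply: eq_bigr => j _; rewrite -iterSr.
by case: ifP => // kd; rewrite /path_weight gen_diff_iter.
Qed.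

(** Since $S^kf$ vanishes at [v] for [k] beyond the depth, the formal series
    $\sum_k\hat\varphi(k)S^k$ may be cut at any such [N]. *)
Lemma GammaE (phi : nat -> R[i]) f v N : (depth E root v < N)%N ->
  Gam phi f v = \sum_(k < N) phi k * iter k S f v.
Proof.
move=> dN; rewrite /Gamma (big_ord_widen N (fun k =>
  (path_weight E lambda (iter k (par E) v) v)%:C * phi k * f (iter k (par E) v))) //.
rewrite big_mkcond; apply: eq_bigr => k _; rewrite ltnS iter_shift_fun.
by case: ifP => _; rewrite ?mulr0 // mulrA [phi k * _]mulrC.
Qed.

Lemma shift_funD f g (c : R[i]) :
  S (fun v => f v + c * g v) = (fun v => S f v + c * S g v).
Proof.
apply/funext => v; rewrite /shift_fun.
by case: ifP => _; rewrite ?mulr0 ?addr0 // mulrDr mulrCA.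
Qed.

Lemma iter_shift_funD k f g (c : R[i]) :
  iter k S (fun v => f v + c * g v) = (fun v => iter k S f v + c * iter k S g v).
Proof. by elim: k => //= k ->; apply: shift_funD. Qed.

Lemma GammaD phi f g (c : R[i]) :
  Gam phi (fun v => f v + c * g v) = (fun v => Gam phi f v + c * Gam phi g v).
Proof.
apply/funext => v; rewrite !(GammaE _ _ _ _ (leqnn _)) mulr_sumr -big_split.
by apply: eq_bigr => k _ /=; rewrite iter_shift_funD mulrDr mulrCA.
Qed.

Lemma Gamma_local phi (s : seq V) f g : stable_seq (par E) s ->
  {in s, f =1 g} -> {in s, Gam phi f =1 Gam phi g}.
Proof.
by move=> sts fg v vs; apply: eq_bigr => k _; rewrite fg // iter_stable.
Qed.

Lemma Gamma_rec phi f v : Gam phi f v =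
  phi 0%N * f v + Gam (fun k => phi k.+1) (S f) v.
Proof.
rewrite (GammaE _ _ _ _ (leqnSn _)) big_ord_recl (GammaE _ _ _ _ (leqnn _)).
by congr (_ + _); apply: eq_bigr => k _; rewrite -iterSr.
Qed.

Lemma shift_Gamma phi f v : S (Gam phi f) v = Gam phi (S f) v.
Proof.
rewrite (GammaE _ _ _ _ (leqnn _)) {1}/shift_fun; case: eqVneq => [->|/eqP vr].
  by rewrite depth_root big_ord1 /= /shift_fun eqxx mulr0.
have dv := depth_par v vr.
rewrite (GammaE _ _ _ (depth E root v).+1) ?dv // mulr_sumr.
apply: eq_bigr => k _; rewrite mulrCA -iterSr iterS {2}/shift_fun.
by rewrite (introF eqP vr).
Qed.

(* [S^k e_u] lives at distance [k] below [u], so at a given vertex at most one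
   term of [Gamma phi e_u] is nonzero. *)
Lemma shift_indic_le_Gamma phi k u v :
  cmod (phi k * iter k S (indic_vertex u) v) <= cmod (Gam phi (indic_vertex u) v).
Proof.
rewrite iter_shift_fun /indic_vertex.
case: ifPn => [kd|_]; last by rewrite mulr0 ComplexField.Normc.normc0 cmod_ge0.
case: eqVneq => [ku|_]; last by rewrite !mulr0 ComplexField.Normc.normc0 cmod_ge0.
rewrite (GammaE _ _ _ _ (leqnn _)) (bigD1 (Ordinal (kd : (k < (depth E root v).+1)%N))) //=.
rewrite big1 ?addr0; first by rewrite iter_shift_fun /indic_vertex kd ku eqxx.
move=> j jk; rewrite iter_shift_fun /indic_vertex; case: ifP => jd; last by rewrite mulr0.
case: eqVneq => ju; last by rewrite !mulr0.
case/eqP: jk; apply/val_inj => /=.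
by rewrite -(gen_diff_iter j v) // ju -ku gen_diff_iter.
Qed.

(** Only [u = iter k (par E) v] can contribute, so there are no cross terms. *)
Lemma iter_shift_sqr_sum k f v (s : seq V) : uniq s -> stable_seq (par E) s -> v \in s ->
  cmod (iter k S f v) ^+ 2
  = \sum_(u <- s) cmod (f u) ^+ 2 * cmod (iter k S (indic_vertex u) v) ^+ 2.
Proof.
move=> us sts vs.
rewrite (bigD1_seq _ (iter_stable _ k v sts vs) us) /= big1 ?addr0; last first.
  move=> u uk; rewrite iter_shift_fun /indic_vertex eq_sym (negPf uk) mulr0 if_same.
  by rewrite ComplexField.Normc.normc0 expr0n mulr0.
rewrite -exprMn -ComplexField.Normc.normcM !iter_shift_fun /indic_vertex eqxx.
by case: ifP => _; rewrite ?mulr0 // mulr1 mulrC.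
Qed.

(** Disjointness of the supports of the $S^ke_u$ lets a bound on indicators pass to general
    functions without loss in the constant. *)
Lemma sqsum_iter_shift_le (beta : V -> R) k (C : R) (s : seq V) f :
  uniq s -> stable_seq (par E) s ->
  (forall u, sqsum beta s (iter k S (indic_vertex u)) <= C * beta u) ->
  sqsum beta s (iter k S f) <= C * sqsum beta s f.
Proof.
move=> us sts indic_le.
have -> : sqsum beta s (iter k S f) =
    \sum_(u <- s) cmod (f u) ^+ 2 * sqsum beta s (iter k S (indic_vertex u)).
  under [RHS]eq_bigr do rewrite mulr_sumr.
  rewrite exchange_big; apply: eq_big_seq => v vs.
  rewrite (iter_shift_sqr_sum _ _ _ _ us sts vs) mulr_suml.
  by apply: eq_bigr => u _; rewrite mulrA.
rewrite mulr_sumr; apply: ler_sum => u _.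
by rewrite mulrCA ler_wpM2l ?sqr_ge0.
Qed.

End Shift.
End Tree.

(** * Bounds on ancestor-closed sets, the resolvent and the spectrum *)

Section Resolvent.
Context {R : realType} {V : choiceType} (E : rel V) (root : V).
Variables beta lambda : V -> R.
Hypothesis tree : rooted_directed_tree E root.
Hypothesis beta_gt0 : forall v, 0 < beta v.
Local Notation S := (shift_fun E root lambda).
Local Notation Gam := (Gamma E root lambda).
Local Notation shift := (weighted_shift E root beta lambda).
Implicit Types (f g : V -> R[i]) (s t : seq V).

(** [C] plays the role of a squared operator norm, whence the exponents [2 * k] below. As [f] is
    arbitrary, [resolvent f] can be inserted before it is known to lie in $\ell^2(\beta)$. *)
Definition stable_bound (A : (V -> R[i]) -> V -> R[i]) (C : R) :=
  forall s f, uniq s -> stable_seq (par E) s ->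
    sqsum beta s (A f) <= C * sqsum beta s f.

Lemma shift_stable_bound : bounded_operator beta shift ->
  exists2 C, 0 <= C & stable_bound S C.
Proof.
move=> [_ stableS _ [M leM]]; exists (M ^+ 2); first exact: sqr_ge0.
move=> s f us sts; apply: (sqsum_iter_shift_le E root tree lambda beta 1) => // u.
have lu := @l2_indic _ _ _ beta_gt0 u.
apply: le_trans (l2_sqsum_le _ beta_gt0 _ _ (stableS _ lu) us) _.
have leMu := leM _ lu.
apply: (@le_trans _ _ ((M * l2_norm beta (indic_vertex u)) ^+ 2)).
  by rewrite ler_sqr ?nnegrE ?l2_norm_ge0 // (le_trans _ leMu) ?l2_norm_ge0.
rewrite exprMn ler_wpM2l ?sqr_ge0 // l2_norm_le // => t ut.
exact: sqsum_indic_le.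
Qed.

Lemma iter_shift_stable_bound (C : R) n : 0 <= C -> stable_bound S C ->
  stable_bound (iter n S) (C ^+ n).
Proof.
move=> C0 SC s f us sts; elim: n => [|n IH]; first by rewrite expr0 mul1r.
by apply: le_trans (SC _ _ us sts) _; rewrite exprS -mulrA ler_wpM2l.
Qed.

(** On indicators each term [phi k] $S^ke_u$ is dominated pointwise by [Gam phi] $e_u$, so the
    single constant of the gliding hump serves all [k]. *)
Lemma multiplier_stable_bound (phi : nat -> R[i]) :
  multipliers E root beta lambda phi ->
  exists2 K, 0 <= K &
    forall k, stable_bound (fun f v => phi k * iter k S f v) K.
Proof.
move=> phiM.
have phi_l2 f : l2 beta f -> l2 beta (Gam phi f).
  by move=> lf; have : op_dom (mult_operator E root beta lambda phi) f
    by [rewrite phiM]; case.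
have [K KP] := @uniform_indic_bound _ _ _ _ beta_gt0 (stable_closure_par E root tree)
  (Gam phi) (fun s f g => Gamma_local E root lambda phi s f g)
  (fun f g c v => congr1 (@^~ v) (GammaD E root tree lambda phi f g c)) phi_l2.
have K0 : 0 <= K.
  (* The empty sum at the root shows that [K] is nonnegative. *)
  by rewrite -(pmulr_lge0 _ (beta_gt0 root)) (le_trans _ (KP root [::] isT)) // sqsum_ge0.
exists K => // k s f us sts; rewrite sqsumZ.
have [->|phik] := eqVneq (phi k) 0.
  by rewrite ComplexField.Normc.normc0 expr0n mul0r mulr_ge0 // sqsum_ge0.
have phik0 : 0 < cmod (phi k) ^+ 2 by rewrite exprn_gt0 // cmod_gt0.
rewrite mulrC -ler_pdivlMr // mulrAC.
apply: (sqsum_iter_shift_le E root tree) => // u.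
rewrite mulrAC ler_pdivlMr // mulrC -sqsumZ; apply: le_trans (KP u s us).
apply: ler_sum => v _; rewrite ler_pM2r //.
by rewrite ler_sqr ?nnegrE ?cmod_ge0 // shift_indic_le_Gamma.
Qed.

Variable z : R[i].
Hypothesis z_neq0 : z != 0.

(* The pointwise inverse of [S - z] is the formal Neumann series, which at each
   vertex is a finite sum. *)
Definition resolvent := Gam (fun k => - z^-1 ^+ k.+1).

Lemma resolvent_shift f v :
  resolvent f v = - z^-1 * f v + z^-1 * resolvent (S f) v.
Proof.
rewrite /resolvent (Gamma_rec _ _ tree) expr1; congr (_ + _).
rewrite !(GammaE _ _ tree _ _ _ _ _ (leqnn _)) mulr_sumr.
by apply: eq_bigr => k _; rewrite mulrA mulrN -exprS.
Qed.

Lemma resolventK f v : resolvent (S f) v - z * resolvent f v = f v.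
Proof. by rewrite (resolvent_shift f); field. Qed.

(** Iterates $T=-z^{-1}+z^{-1}ST$ for the resolvent $T$: [h] collects the first [n] Neumann terms,
    and [H] is uniform in [f]. *)
Lemma resolvent_expansion (C : R) n : 0 <= C -> stable_bound S C ->
  exists2 H, 0 <= H & forall f, exists h,
    (forall v, resolvent f v = h v + z^-1 ^+ n * iter n S (resolvent f) v) /\
    forall s, uniq s -> stable_seq (par E) s ->
      sqsum beta s h <= H * sqsum beta s f.
Proof.
move=> C0 SC; elim: n => [|n [H H0 HP]].
  exists 0 => // f; exists (fun=> 0); split=> [v|s _ _]; last by rewrite sqsum0 mul0r.
  by rewrite add0r expr0 mul1r.
set a := cmod (- z^-1 ^+ n.+1) ^+ 2.
have a0 : 0 <= a by apply: sqr_ge0.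
exists ((1 + 1) * H + (1 + 1) * (a * C ^+ n)).
  by rewrite addr_ge0 // mulr_ge0 // mulr_ge0 // exprn_ge0.
move=> f; have [h [hE hH]] := HP f.
exists (fun v => h v + - z^-1 ^+ n.+1 * iter n S f v); split=> [v|s us sts].
  rewrite {1}hE -addrA; congr (_ + _).
  have -> : iter n S (resolvent f) v =
      z^-1 * (iter n.+1 S (resolvent f) v - iter n S f v).
    (* The zero function and the factor [-1] bring $Tf=z^{-1}(STf-f)$ to the shape [f v + c * g v]
       of [iter_shift_funD]. *)
    have {1}-> : resolvent f =
        (fun v => (fun=> 0) v + z^-1 * (fun v => S (resolvent f) v + -1 * f v) v).
      apply/funext => x; rewrite add0r {1}resolvent_shift /resolvent -shift_Gamma //.
      by rewrite mulrDr addrC mulN1r mulrN mulNr.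
    rewrite (iter_shift_funD E root lambda n (fun=> 0)) iter_shift_funD.
    have -> : iter n S (fun=> 0) v = 0.
      by rewrite (iter_shift_fun _ _ tree) mulr0 if_same.
    by rewrite add0r mulN1r iterSr.
  by rewrite mulrA -exprSr mulrBr mulNr addrC.
apply: le_trans (sqsumD_le _ beta_gt0 1 _ _ _ ltr01) _.
rewrite sqsumZ invr1 [leRHS]mulrDl lerD // -!mulrA ler_wpM2l ?hH //.
by rewrite !ler_wpM2l ?cmod_ge0 //; apply: iter_shift_stable_bound.
Qed.

(** The remainder of the expansion at [n = k] has at most [q] times the square sum of [resolvent f],
    where [q < 1]. *)
Lemma resolvent_stable_bound (C D : R) k : 0 <= C -> stable_bound S C ->
  stable_bound (iter k S) D -> D < cmod z ^+ (2 * k) ->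
  exists2 N, 0 <= N & stable_bound resolvent N.
Proof.
move=> C0 SC SD Dz; have [H H0 HP] := resolvent_expansion C k C0 SC.
have zk0 : 0 < cmod z ^+ (2 * k) by rewrite exprn_gt0 // cmod_gt0.
set q := D / cmod z ^+ (2 * k).
have q1 : q < 1 by rewrite ltr_pdivrMr // mul1r.
(* For this [e], [1 - (1 + e) * q] equals $(1-q)(2-q)/2$, which is positive. *)
set e := (1 - q) / 2.
have e0 : 0 < e by rewrite /e; lra.
have eq1 : 0 < 1 - (1 + e) * q by rewrite /e; nra.
exists ((1 + e^-1) * H / (1 - (1 + e) * q)).
  by apply: divr_ge0; [rewrite mulr_ge0 ?addr_ge0 ?invr_ge0 ?(ltW e0) | apply: ltW].
move=> s f us sts; have [h [hE hH]] := HP f.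
rewrite mulrAC ler_pdivlMr //.
(* The last term below is finite, [s] being a finite sequence, and is absorbed. *)
have : sqsum beta s (resolvent f) <= (1 + e^-1) * sqsum beta s h
    + (1 + e) * (q * sqsum beta s (resolvent f)).
  rewrite [leLHS](sqsum_eq _ _ _ _ (fun v _ => hE v)).
  apply: le_trans (sqsumD_le _ beta_gt0 e _ _ _ e0) _.
  rewrite lerD2l ler_wpM2l ?addr_ge0 ?(ltW e0) // sqsumZ.
  rewrite cmodX ComplexField.Normc.normcV exprVn exprVn -exprM [(k * 2)%N]mulnC.
  rewrite mulrC ler_pdivrMr // /q mulrAC divfK ?gt_eqF //; exact: SD.
have := hH s us sts; rewrite -(ler_pM2l (_ : 0 < 1 + e^-1)); last by rewrite addr_gt0 ?invr_gt0.
set X := sqsum beta s (resolvent f); set Y := sqsum beta s h.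
set F := sqsum beta s f.
rewrite mulrA; lra.
Qed.

(** For smaller [D] the resolvent is bounded, and it is a two-sided inverse of $S-z$ because $S$
    commutes with [Gam]. *)
Lemma spectrum_le (C D : R) k : 0 <= C -> stable_bound S C ->
  stable_bound (iter k S) D -> spectrum beta shift z -> cmod z ^+ (2 * k) <= D.
Proof.
move=> C0 SC SD; apply: contra_notP => /negP; rewrite -ltNge => Dz.
have [N N0 BN] := resolvent_stable_bound C D k C0 SC SD Dz.
have res_le f s : l2 beta f -> uniq s ->
    sqsum beta s (resolvent f) <= N * l2_norm beta f ^+ 2.
  move=> lf us; have [t [ut stt st]] := stable_closure_par E root tree s.
  apply: le_trans (sqsum_sub _ beta_gt0 _ _ _ us st) _.
  apply: le_trans (BN t f ut stt) _.
  by rewrite ler_wpM2l // l2_sqsum_le.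
exists (Operator (l2 beta) resolvent); split; first split=> //=.
- move=> f lf; apply: (@sqsum_le_l2_mem _ _ _ _ (N * l2_norm beta f ^+ 2)) => s.
  exact: res_le.
- move=> a f g _ _; under eq_fun do rewrite addrC.
  by rewrite /resolvent GammaD //; apply/funext => v; rewrite addrC.
- exists (Num.sqrt N) => f lf.
  rewrite -ler_sqr ?nnegrE ?mulr_ge0 ?sqrtr_ge0 ?l2_norm_ge0 //.
  rewrite exprMn (sqr_sqrtr N0); by apply: l2_norm_le => // s; apply: res_le.
move=> f _ /=; split; apply/funext => v.
  under [X in resolvent X]eq_fun do rewrite -mulNr.
  by rewrite /resolvent GammaD // mulNr resolventK.
by rewrite /resolvent shift_Gamma // resolventK.
Qed.

End Resolvent.

(** * Absolute convergence inside the spectral radius *)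

Theorem proposition6 (R : realType) (V : choiceType) (E : rel V) (root : V)
    (beta lambda : V -> R)
    (hV : ([set: V] #= [set: nat])%card)
    (hT : rooted_directed_tree E root)
    (hleaf : leafless E)
    (hbeta : forall v, 0 < beta v)
    (hlambda : forall v, v <> root -> 0 < lambda v)
    (hS : bounded_operator beta (weighted_shift E root beta lambda))
    (phi : nat -> R[i])
    (hphi : multipliers E root beta lambda phi)
    (w : R[i])
    (hw : cmod w < spectral_radius beta (weighted_shift E root beta lambda)) :
  cvgn (series (fun n => cmod (phi n * w ^+ n)) : R^nat).
Proof.
(* If the set of moduli has no supremum, [sup] takes the default value 0, and no modulus lies below
   0. *)
have [z zspec wz] : exists2 z,
    spectrum beta (weighted_shift E root beta lambda) z & cmod w < cmod z.
  have [hs|/sup_out s0] := pselect (has_sup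
      [set cmod z | z in spectrum beta (weighted_shift E root beta lambda)]).
    have : 0 < spectral_radius beta (weighted_shift E root beta lambda) - cmod w.
      by rewrite subr_gt0.
    by move=> /sup_adherent/(_ hs)[_ [z zs <-]]; rewrite subKr; exists z.
  by move: hw; rewrite /spectral_radius s0 ltNge cmod_ge0.
have z0 : 0 < cmod z by apply: le_lt_trans wz; apply: cmod_ge0.
have z_neq0 : z != 0.
  by apply: contraTneq z0 => ->; rewrite ComplexField.Normc.normc0 ltxx.
have [C C0 SC] := shift_stable_bound E root beta lambda hT hbeta hS.
have [K K0 KP] := multiplier_stable_bound E root beta lambda hT hbeta phi hphi.
(* [spectrum_le] is applied with [D = K / cmod (phi n) ^+ 2], hence the separate case
   [phi n = 0]. *)
have phi_le n : cmod (phi n) * cmod z ^+ n <= Num.sqrt K.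
  rewrite -[leLHS]ger0_norm ?mulr_ge0 ?exprn_ge0 ?cmod_ge0 // -sqrtr_sqr.
  rewrite ler_wsqrtr // exprMn -exprM mulnC.
  have [->|phin] := eqVneq (phi n) 0.
    by rewrite ComplexField.Normc.normc0 expr0n mul0r.
  have phin0 : 0 < cmod (phi n) ^+ 2 by rewrite exprn_gt0 // cmod_gt0.
  rewrite mulrC -ler_pdivlMr //.
  apply: (spectrum_le E root beta lambda hT hbeta z z_neq0 C) zspec => // s f us sts.
  by rewrite mulrAC ler_pdivlMr // mulrC -sqsumZ KP.
apply: (@series_le_cvg _ _ (geometric (Num.sqrt K) (cmod w / cmod z))) => [n|n|n|].
- exact: cmod_ge0.
- by rewrite /geometric /= mulr_ge0 ?sqrtr_ge0 // exprn_ge0 // divr_ge0 ?cmod_ge0.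
- rewrite /geometric /= ComplexField.Normc.normcM cmodX expr_div_n.
  rewrite mulrA ler_pdivlMr ?exprn_gt0 // mulrAC ler_wpM2r //.
  by rewrite exprn_ge0 // cmod_ge0.
apply: is_cvg_geometric_series.
by rewrite ger0_norm ?divr_ge0 ?cmod_ge0 // ltr_pdivrMr ?mul1r.
Qed.
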